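(* (Single-domain minimax-regret prediction.) Let $\mathcal{A}$ and $\mathcal{B}$ be linear subspaces of functions from $\mathbb{R}^{M_1}$ to $\mathbb{R}^N$ and from $\mathbb{R}^{M_2}$ to $\mathbb{R}^N$, respectively, and let $\mathcal{F}$ be the set of joint distributions of $(X_1,X_2,Y)$ defined in the context. The solution to the problem $$\rho_{\mathrm{S}}=\arg\min_{\rho}\ \sup_{F_{X_1X_2Y}\in\mathcal{F}}\mathrm{REG}(F_{X_1X_2Y},\rho),$$ where minimization is performed only over functions $\rho$ of $X_1$, and $$\mathrm{REG}(F_{X_1X_2Y},\rho)=\mathbb{E}\left[\|Y-\rho(X_1)\|^2\right]-\mathbb{E}\left[\|Y-\mathbb{E}[Y|X_1]\|^2\right],$$ is given by $$\rho_{\mathrm{S}}(X_1)=\mathbb{E}[\rho_{\mathrm{M}}(X_1,X_2)\,|\,X_1],$$ where $\rho_{\mathrm{M}}(X_1,X_2)$ is the multi-domain minimax estimator $$\rho_{\mathrm{M}}=\arg\min_{\rho}\ \sup_{F_{X_1X_2Y}\in\mathcal{F}}\mathbb{E}\left[\|Y-\rho(X_1,X_2)\|^2\right],$$ the last minimization being over all functions $\rho$ of $X_1$ and $X_2$.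
   Context: $X_1,X_2,Y$ are random vectors taking values in $\mathbb{R}^{M_1},\mathbb{R}^{M_2},\mathbb{R}^N$, respectively. Given are: linear subspaces $\mathcal{A}$ and $\mathcal{B}$ of functions $\mathbb{R}^{M_1}\to\mathbb{R}^N$ and $\mathbb{R}^{M_2}\to\mathbb{R}^N$ (for example, all linear functions, all Borel-measurable functions, or only the zero function), two functions $\varphi_{\mathcal{A}}:\mathbb{R}^{M_1}\to\mathbb{R}^N$ and $\psi_{\mathcal{B}}:\mathbb{R}^{M_2}\to\mathbb{R}^N$, a cumulative distribution function $F_{X_1X_2}$ on $\mathbb{R}^{M_1}\times\mathbb{R}^{M_2}$, and a scalar $c>0$. $\mathcal{F}$ is the set of joint distributions $F_{X_1X_2Y}$ of $(X_1,X_2,Y)$ satisfying (i) $\varphi_{\mathcal{A}}=\arg\min_{\varphi\in\mathcal{A}}\mathbb{E}[\|Y-\varphi(X_1)\|^2]$; (ii) $\psi_{\mathcal{B}}=\arg\min_{\psi\in\mathcal{B}}\mathbb{E}[\|Y-\psi(X_2)\|^2]$; (iii) the marginal distribution of $(X_1,X_2)$ is $F_{X_1X_2}$, i.e. $F_{X_1X_2Y}(\boldsymbol{x}_1,\boldsymbol{x}_2,\infty)=F_{X_1X_2}(\boldsymbol{x}_1,\boldsymbol{x}_2)$; (iv) $\mathbb{E}[\|Y\|^2]=c$. All expectations involving $Y$ are with respect to the distribution $F_{X_1X_2Y}$ under consideration. *)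

(* Defs.v *)
From HB Require Import structures.
From mathcomp Require Import all_boot all_order all_algebra.
From mathcomp Require Import all_classical all_reals all_analysis.

Set Implicit Arguments.
Unset Strict Implicit.
Unset Printing Implicit Defensive.

Import Order.TTheory GRing.Theory Num.Theory.
Import numFieldNormedType.Exports.

Local Open Scope classical_set_scope.
Local Open Scope ring_scope.

(* R^n is 'rV[R]_n.  Its sigma-algebra is generated by the n coordinates, as
   the library does for n.-tuple; it is the Borel sigma-algebra of R^n. *)
Section measurable_rV.
Context {R : realType} (n : nat).

Definition rV_coord (i : 'I_n) (v : 'rV[R]_n) : R := v ord0 i.

Let rV_set0 : g_sigma_preimage rV_coord set0.
Proof. exact: sigma_algebra0. Qed.

Let rV_setC (A : set 'rV[R]_n) :
  g_sigma_preimage rV_coord A -> g_sigma_preimage rV_coord (~` A).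
Proof. exact: sigma_algebraC. Qed.

Let rV_bigcup (F : (set 'rV[R]_n)^nat) :
  (forall i, g_sigma_preimage rV_coord (F i)) ->
  g_sigma_preimage rV_coord (\bigcup_i (F i)).
Proof. exact: sigma_algebra_bigcup. Qed.

HB.instance Definition _ :=
  @isMeasurable.Build (measure_tuple_display default_measure_display)
    'rV[R]_n (g_sigma_preimage rV_coord) rV_set0 rV_setC rV_bigcup.

End measurable_rV.

Section minimax_regret.
Context {R : realType}.

Definition sqnorm n (v : 'rV[R]_n) : R := \sum_(i < n) v ord0 i ^+ 2.

Definition argmin T (D : set T) (f : T -> \bar R) : set T :=
  [set x | D x /\ forall y, D y -> (f x <= f y)%E].

(* g : R^m -> R^n is a version of the regression function x |-> E[Z | X = x],
   i.e. g(X) is a version of E[Z | X], componentwise. *)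
Definition is_cond_exp d (T : measurableType d) (P : probability T R) m n
    (X : T -> 'rV[R]_m) (Z : T -> 'rV[R]_n) (g : 'rV[R]_m -> 'rV[R]_n) : Prop :=
  measurable_fun setT g /\
  forall i : 'I_n,
    [/\ P.-integrable setT (fun w => (Z w ord0 i)%:E),
        P.-integrable setT (fun w => (g (X w) ord0 i)%:E) &
        forall C, measurable C ->
          (\int[P]_(w in X @^-1` C) (g (X w) ord0 i)%:E =
           \int[P]_(w in X @^-1` C) (Z w ord0 i)%:E)%E].

(* A chosen version (any two agree almost surely); it is the zero function when
   there is none, i.e. when Z is not integrable. *)
Definition cond_exp d (T : measurableType d) (P : probability T R) m n
    (X : T -> 'rV[R]_m) (Z : T -> 'rV[R]_n) : 'rV[R]_m -> 'rV[R]_n :=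
  xget (fun=> 0) [set g | is_cond_exp P X Z g].

Section problem.
Context {M1 M2 N : nat}.

(* A joint distribution of (X1, X2, Y) is a Borel probability measure P on the
   canonical space (R^M1 * R^M2) * R^N, whose coordinates are X1, X2 and Y. *)
Local Notation joint := ('rV[R]_M1 * 'rV[R]_M2 * 'rV[R]_N)%type.

Definition X1 (w : joint) : 'rV[R]_M1 := w.1.1.
Definition X2 (w : joint) : 'rV[R]_M2 := w.1.2.
Definition X12 (w : joint) : 'rV[R]_M1 * 'rV[R]_M2 := w.1.
Definition Y (w : joint) : 'rV[R]_N := w.2.

(* E[ ||Y - rho(U)||^2 ] for the observation U, under P. *)
Definition mse (P : probability joint R) V (U : joint -> V)
    (rho : V -> 'rV[R]_N) : \bar R :=
  ('E_P[fun w => sqnorm (Y w - rho (U w))])%E.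

Definition feasible (A : set ('rV[R]_M1 -> 'rV[R]_N))
    (B : set ('rV[R]_M2 -> 'rV[R]_N))
    (phiA : 'rV[R]_M1 -> 'rV[R]_N) (psiB : 'rV[R]_M2 -> 'rV[R]_N)
    (P12 : probability ('rV[R]_M1 * 'rV[R]_M2)%type R) (c : R) :
    set (probability joint R) :=
  [set P | [/\ argmin A (mse P X1) phiA,
              argmin B (mse P X2) psiB,
              forall C, measurable C -> P (X12 @^-1` C) = P12 C &
              ('E_P[fun w => sqnorm (Y w)] = c%:E)%E]].

Definition REG (P : probability joint R) (rho : 'rV[R]_M1 -> 'rV[R]_N) :
    \bar R :=
  (mse P X1 rho - mse P X1 (cond_exp P X1 Y))%E.

(* In both problems the candidates are the Borel-measurable functions, the ones
   for which the expectations make sense. *)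
Definition multi_domain_minimax (F : set (probability joint R)) :
    set ('rV[R]_M1 * 'rV[R]_M2 -> 'rV[R]_N) :=
  argmin [set rho | measurable_fun setT rho]
         (fun rho => ereal_sup [set mse P X12 rho | P in F]).

Definition single_domain_minimax_regret (F : set (probability joint R)) :
    set ('rV[R]_M1 -> 'rV[R]_N) :=
  argmin [set rho | measurable_fun setT rho]
         (fun rho => ereal_sup [set REG P rho | P in F]).

End problem.
End minimax_regret.

(* Main.v *)
(** On square-integrable functions, let [m] be the projection of [Y] onto the
closure of [A + B], viewed as a function of [(X1, X2)].  The optimality of
[phiA] and [psiB] prescribes the inner products of [Y] with [A + B], so [m] does
not depend on the feasible law, and reflecting [Y] into [2 m(X1, X2) - Y] maps
feasible laws to feasible laws.  Averaging the mean squared error of an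
estimator over a law and its reflection, the parallelogram law shows that [rhoM]
must be [m] almost surely.  The reflection also turns [E[Y | X1]] into
[2 E[m | X1] - E[Y | X1]], and since the regret of [rho] is the squared distance
from [E[Y | X1]] to [rho(X1)], the same averaging shows that [E[m | X1]] is the
unique minimizer of the worst-case regret. *)

Require Import Defs.
From HB Require Import structures.
From mathcomp Require Import all_boot all_order all_algebra.
From mathcomp Require Import all_classical all_reals all_analysis.
From mathcomp Require Import measurable_realfun.
From mathcomp Require Import ring lra.

Set Implicit Arguments.
Unset Strict Implicit.
Unset Printing Implicit Defensive.

Import Order.TTheory GRing.Theory Num.Theory.
Import numFieldNormedType.Exports.

Local Open Scope classical_set_scope.
Local Open Scope ring_scope.

(** * Square-integrable random vectors *)

Section measurable_rV.
Context d (T : measurableType d) (R : realType) (n : nat).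
Implicit Types f g : T -> 'rV[R]_n.

(** The coordinate maps generate the sigma-algebra, so it suffices to test preimages of
    generators. *)
Lemma measurable_rVP f :
  measurable_fun setT f <->
  forall i : 'I_n, measurable_fun setT (fun x => f x ord0 i).
Proof.
split=> [mf i|mf].
  have mc : measurable_fun setT (@rV_coord R n i).
    move=> _ C mC; rewrite setTI; apply: sub_sigma_algebra.
    rewrite -bigcup_seq/=; exists i => /=; first by rewrite mem_index_enum.
    by exists C => //; rewrite setTI.
  exact: (measurableT_comp mc mf).
apply: (@measurability _ _ _ _ setT f
  (\big[setU/set0]_(i < n) preimage_set_system setT (rV_coord i) measurable)) => //.
move=> _ [C + <-]; rewrite -bigcup_seq/= => -[i _ [D mD <-]].
by rewrite setTI -comp_preimage; exact: mf.
Qed.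

Lemma measurable_rVD f g : measurable_fun setT f -> measurable_fun setT g ->
  measurable_fun setT (f + g).
Proof.
move=> /measurable_rVP mf /measurable_rVP mg; apply/measurable_rVP => i.
rewrite (_ : (fun _ => _) = (fun x => f x ord0 i + g x ord0 i)).
  exact: measurable_funD.
by apply/funext => x; rewrite fctE mxE.
Qed.

Lemma measurable_rVZ (a : R) f : measurable_fun setT f ->
  measurable_fun setT (a *: f).
Proof.
move=> /measurable_rVP mf; apply/measurable_rVP => i.
rewrite (_ : (fun _ => _) = (fun x => a * f x ord0 i)).
  exact: measurable_funM.
by apply/funext => x; rewrite fctE mxE.
Qed.

Lemma measurable_rV0 : measurable_fun setT (0 : T -> 'rV[R]_n).
Proof. exact: measurable_cst. Qed.

Lemma measurable_rVB f g : measurable_fun setT f -> measurable_fun setT g ->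
  measurable_fun setT (f - g).
Proof.
move=> mf mg; apply: measurable_rVD => //.
by rewrite -scaleN1r; exact: measurable_rVZ.
Qed.

End measurable_rV.

Lemma coordB (T : Type) (R : realType) n (f g : T -> 'rV[R]_n) w i :
  (f - g) w ord0 i = f w ord0 i - g w ord0 i.
Proof. by rewrite fctE mxE [X in _ + X]mxE. Qed.

(** * Euclidean inner product and square-integrable vectors *)

Definition dotv (R : realType) n (u v : 'rV[R]_n) : R :=
  \sum_(i < n) u ord0 i * v ord0 i.

Definition L2 d (T : measurableType d) (R : realType) (P : probability T R) n
    (f : T -> 'rV[R]_n) : Prop :=
  measurable_fun setT f /\ (\int[P]_w (sqnorm (f w))%:E < +oo)%E.

(** The integral is cut down to a real number, so the algebraic laws below carry [L2] hypotheses.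
    Functions are not quotiented by null sets: being equal in the Hilbert space is expressed by
    [nsq P (f - g) = 0]. *)
Definition ip d (T : measurableType d) (R : realType) (P : probability T R) n
    (f g : T -> 'rV[R]_n) : R :=
  \int[P]_w dotv (f w) (g w).

Section dotv.
Context (R : realType) (n : nat).
Implicit Types u v w : 'rV[R]_n.

Lemma dotvC u v : dotv u v = dotv v u.
Proof. by apply: eq_bigr => i _; rewrite mulrC. Qed.

Lemma dotvDl u v w : dotv (u + v) w = dotv u w + dotv v w.
Proof. by rewrite -big_split; apply: eq_bigr => i _; rewrite mxE mulrDl. Qed.

Lemma dotvZl a u v : dotv (a *: u) v = a * dotv u v.
Proof. by rewrite mulr_sumr; apply: eq_bigr => i _; rewrite mxE mulrA. Qed.

Lemma dotvv u : dotv u u = sqnorm u.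
Proof. by apply: eq_bigr => i _; rewrite expr2. Qed.

Lemma sqnorm_ge0 u : 0 <= sqnorm u.
Proof. by apply: sumr_ge0 => i _; exact: sqr_ge0. Qed.

Lemma sqnorm_eq0 u : sqnorm u = 0 -> u = 0.
Proof.
move=> u0; apply/rowP => i; apply/eqP; rewrite mxE -sqrf_eq0.
by rewrite (psumr_eq0P _ u0)// => j _; exact: sqr_ge0.
Qed.

Lemma sqnormD u v : sqnorm (u + v) <= 2 * sqnorm u + 2 * sqnorm v.
Proof.
rewrite !mulr_sumr -big_split/=; apply: ler_sum => i _; rewrite mxE.
by have := sqr_ge0 (u ord0 i - v ord0 i); nra.
Qed.

Lemma sqnormZ a u : sqnorm (a *: u) = a ^+ 2 * sqnorm u.
Proof. by rewrite mulr_sumr; apply: eq_bigr => i _; rewrite mxE exprMn. Qed.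

Lemma abs_dotv u v : `|dotv u v| <= sqnorm u + sqnorm v.
Proof.
rewrite (le_trans (ler_norm_sum _ _ _))// -big_split ler_sum//= => i _.
rewrite ler_norml; have := sqr_ge0 (u ord0 i - v ord0 i).
by have := sqr_ge0 (u ord0 i + v ord0 i); move=> *; apply/andP; split; nra.
Qed.

Lemma coord_sqnorm u i : u ord0 i ^+ 2 <= sqnorm u.
Proof.
by rewrite /sqnorm (bigD1 i)//= lerDl sumr_ge0// => j _; exact: sqr_ge0.
Qed.

End dotv.

(** * Hilbert-space geometry of square-integrable vectors *)

Section L2_space.
Context d (T : measurableType d) (R : realType) (P : probability T R) (n : nat).
Implicit Types f g h : T -> 'rV[R]_n.

Lemma measurable_dotv f g : measurable_fun setT f -> measurable_fun setT g ->
  measurable_fun setT (fun w => dotv (f w) (g w)).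
Proof.
move=> /measurable_rVP mf /measurable_rVP mg.
by apply: measurable_sum => i; exact: measurable_funM.
Qed.

Lemma measurable_sqnorm f : measurable_fun setT f ->
  measurable_fun setT (fun w => sqnorm (f w)).
Proof.
move=> mf; under eq_fun do rewrite -dotvv; exact: measurable_dotv.
Qed.

Lemma measurable_sqnormE f : measurable_fun setT f ->
  measurable_fun setT (fun w => (sqnorm (f w))%:E).
Proof. by move=> mf; apply/measurable_EFinP; exact: measurable_sqnorm. Qed.

Lemma integrable_sqnorm f : L2 P f ->
  P.-integrable setT (EFin \o (fun w => sqnorm (f w))).
Proof.
move=> [mf foo]; apply/integrableP; split; first exact: measurable_sqnormE.
by under eq_integral do rewrite /= ger0_norm ?sqnorm_ge0//.
Qed.

Lemma L2_le f (b : T -> R) : measurable_fun setT f ->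
  P.-integrable setT (EFin \o b) -> (forall w, sqnorm (f w) <= b w) -> L2 P f.
Proof.
move=> mf ib fb; split=> //; apply: le_lt_trans (integrable_lty _ ib) => //.
apply: ge0_le_integral => //.
- by move=> w _; rewrite lee_fin sqnorm_ge0.
- exact: measurable_sqnormE.
- by have /integrableP[] := ib.
- by move=> w _; rewrite lee_fin.
Qed.

Lemma L2D f g : L2 P f -> L2 P g -> L2 P (f + g).
Proof.
move=> f2 g2; apply: (@L2_le _ (fun w => 2 * sqnorm (f w) + 2 * sqnorm (g w))).
- by apply: measurable_rVD; [case: f2|case: g2].
- have -> : EFin \o (fun w => 2 * sqnorm (f w) + 2 * sqnorm (g w)) =
    (fun w => 2%:E * (EFin \o (fun w => sqnorm (f w))) w)%E \+
    (fun w => 2%:E * (EFin \o (fun w => sqnorm (g w))) w)%E by [].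
  by apply: integrableD => //; apply: integrableZl => //; exact: integrable_sqnorm.
- by move=> w; exact: sqnormD.
Qed.

Lemma L2Z a f : L2 P f -> L2 P (a *: f).
Proof.
move=> f2; apply: (@L2_le _ (fun w => a ^+ 2 * sqnorm (f w))).
- by apply: measurable_rVZ; case: f2.
- have -> : EFin \o (fun w => a ^+ 2 * sqnorm (f w)) =
    (fun w => (a ^+ 2)%:E * (EFin \o (fun w => sqnorm (f w))) w)%E by [].
  by apply: integrableZl => //; exact: integrable_sqnorm.
- by move=> w; rewrite -sqnormZ.
Qed.

Lemma L2N f : L2 P f -> L2 P (- f).
Proof. by rewrite -scaleN1r; exact: L2Z. Qed.

Lemma L2B f g : L2 P f -> L2 P g -> L2 P (f - g).
Proof. by move=> f2 g2; apply: L2D => //; exact: L2N. Qed.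

Lemma L2_bounded f (b : R) : measurable_fun setT f ->
  (forall w, sqnorm (f w) <= b) -> L2 P f.
Proof.
move=> mf fb; apply: (@L2_le f (cst b)) => //.
exact: finite_measure_integrable_cst.
Qed.

Lemma L2_0 : L2 P (0 : T -> 'rV[R]_n).
Proof.
apply: (@L2_bounded _ 0); first exact: measurable_rV0.
by move=> w; rewrite /sqnorm big1// => i _; rewrite mxE expr0n.
Qed.

Lemma integrable_dotv f g : L2 P f -> L2 P g ->
  P.-integrable setT (EFin \o (fun w => dotv (f w) (g w))).
Proof.
move=> f2 g2; apply: (@le_integrable _ _ _ _ _ measurableT _
  ((EFin \o (fun w => sqnorm (f w))) \+ (EFin \o (fun w => sqnorm (g w))))).
- by apply/measurable_EFinP; apply: measurable_dotv; [case: f2|case: g2].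
- move=> w _; rewrite /= lee_fin (le_trans (abs_dotv _ _))//.
  by rewrite ler_norm.
- by apply: integrableD => //; exact: integrable_sqnorm.
Qed.

Lemma ip_sqnorm f : L2 P f -> (\int[P]_w (sqnorm (f w))%:E)%E = (ip P f f)%:E.
Proof.
move=> f2; rewrite /ip /Rintegral; under [in RHS]eq_integral do rewrite dotvv.
by rewrite fineK// (integrable_fin_num _ (integrable_sqnorm f2)).
Qed.

Lemma ipC f g : ip P f g = ip P g f.
Proof. by apply: eq_Rintegral => w _; rewrite dotvC. Qed.

Lemma ipDl f g h : L2 P f -> L2 P g -> L2 P h ->
  ip P (f + g) h = ip P f h + ip P g h.
Proof.
move=> f2 g2 h2; rewrite /ip -RintegralD//; try exact: integrable_dotv.
by apply: eq_Rintegral => w _; rewrite -dotvDl.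
Qed.

Lemma ipZl a f g : L2 P f -> L2 P g -> ip P (a *: f) g = a * ip P f g.
Proof.
move=> f2 g2; rewrite /ip -RintegralZl//; last exact: integrable_dotv.
by apply: eq_Rintegral => w _; rewrite -dotvZl.
Qed.

Lemma ipNl f g : L2 P f -> L2 P g -> ip P (- f) g = - ip P f g.
Proof. by move=> f2 g2; rewrite -scaleN1r ipZl// mulN1r. Qed.

Lemma ipBl f g h : L2 P f -> L2 P g -> L2 P h ->
  ip P (f - g) h = ip P f h - ip P g h.
Proof. by move=> f2 g2 h2; rewrite ipDl// ?ipNl//; exact: L2N. Qed.

Lemma ipDr f g h : L2 P f -> L2 P g -> L2 P h ->
  ip P h (f + g) = ip P h f + ip P h g.
Proof. by move=> f2 g2 h2; rewrite ipC ipDl// !(ipC h). Qed.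

Lemma ipZr a f g : L2 P f -> L2 P g -> ip P g (a *: f) = a * ip P g f.
Proof. by move=> f2 g2; rewrite ipC ipZl// ipC. Qed.

Lemma ipBr f g h : L2 P f -> L2 P g -> L2 P h ->
  ip P h (f - g) = ip P h f - ip P h g.
Proof. by move=> f2 g2 h2; rewrite ipC ipBl// !(ipC h). Qed.

Definition nsq f := ip P f f.

Lemma nsq_ge0 f : 0 <= nsq f.
Proof. by apply: Rintegral_ge0 => w _; rewrite dotvv sqnorm_ge0. Qed.

Lemma nsqN f : nsq (- f) = nsq f.
Proof.
apply: eq_Rintegral => w _; rewrite !dotvv; apply: eq_bigr => i _.
by rewrite fctE mxE sqrrN.
Qed.

Lemma nsqD f g : L2 P f -> L2 P g ->
  nsq (f + g) = nsq f + 2 * ip P f g + nsq g.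
Proof.
move=> f2 g2; have fg2 := L2D f2 g2.
by rewrite /nsq ipDl// !ipDr// (ipC g f); ring.
Qed.

Lemma nsqZ a f : L2 P f -> nsq (a *: f) = a ^+ 2 * nsq f.
Proof. by move=> f2; have := L2Z a f2 => af; rewrite /nsq ipZl// ipZr//; ring. Qed.

Lemma nsqB f g : L2 P f -> L2 P g ->
  nsq (f - g) = nsq f - 2 * ip P f g + nsq g.
Proof.
move=> f2 g2; have g2' := L2N g2.
by rewrite nsqD// nsqN -scaleN1r ipZr//; ring.
Qed.

Lemma parallelogram f g : L2 P f -> L2 P g ->
  nsq (f - g) + nsq (f + g) = 2 * nsq f + 2 * nsq g.
Proof. by move=> f2 g2; rewrite nsqB// nsqD//; ring. Qed.

(** First-order optimality. With [x = ip P f h], the test value [t = x / (nsq h + 1)] turns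
    minimality into [t ^+ 2 * (nsq h + 2) <= 0]; the added 1 keeps the quotient meaningful when [h]
    is null. *)
Lemma ip_eq0_of_min f h : L2 P f -> L2 P h ->
  (forall t, nsq f <= nsq (f - t *: h)) -> ip P f h = 0.
Proof.
move=> f2 h2 fmin; have H0 := nsq_ge0 h.
set x := ip P f h; have := fmin (x / (nsq h + 1)).
have th2 := L2Z (x / (nsq h + 1)) h2.
rewrite nsqB// ipZr// nsqZ// -/x => le0.
have H1 : 0 < nsq h + 1 by lra.
set t := x / (nsq h + 1) in le0.
have xE : x = t * (nsq h + 1) by rewrite /t divfK ?gt_eqF.
have t0 : t ^+ 2 <= 0.
  move: le0; rewrite xE; have := sqr_ge0 t; set H := nsq h in H0 *.
  move=> tt le0; have : t ^+ 2 * (H + 2) <= 0 by nra.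
  by rewrite pmulr_lle0//; lra.
have /eqP : t ^+ 2 == 0 by rewrite eq_le t0 sqr_ge0.
by move/eqP; rewrite sqrf_eq0 => /eqP t00; rewrite xE t00 mul0r.
Qed.

Lemma cauchy_schwarz f g : L2 P f -> L2 P g -> ip P f g ^+ 2 <= nsq f * nsq g.
Proof.
move=> f2 g2; have F0 := nsq_ge0 f; have G0 := nsq_ge0 g.
have q t : 0 <= nsq f - 2 * t * ip P f g + t ^+ 2 * nsq g.
  have := nsq_ge0 (f - t *: g); have tg2 := L2Z t g2.
  by rewrite nsqB// ipZr// nsqZ//; lra.
have [g0|gn0] := eqVneq (nsq g) 0.
  set x := ip P f g in q *; rewrite g0 mulr0.
  have [->|x0] := eqVneq x 0; first by rewrite expr0n.
  (* If [g] is null the quadratic is affine in [t]; this [t] would give it the value -1. *)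
  have := q ((nsq f + 1) / (2 * x)); rewrite g0 mulr0 addr0.
  by rewrite (_ : 2 * _ * x = nsq f + 1); [lra|field].
have gp : 0 < nsq g by rewrite lt_neqAle eq_sym gn0.
(* The vertex of the parabola. *)
have := q (ip P f g / nsq g); set x := ip P f g.
move=> /(mulr_ge0 G0); rewrite (_ : nsq g * _ = nsq f * nsq g - x ^+ 2); first lra.
by field.
Qed.

(** By Cauchy-Schwarz, functions at distance zero are interchangeable in inner products. *)
Lemma ip_null f g h : L2 P f -> L2 P g -> L2 P h -> nsq (f - g) = 0 ->
  ip P f h = ip P g h.
Proof.
move=> f2 g2 h2 fg0; have := cauchy_schwarz (L2B f2 g2) h2.
rewrite fg0 mul0r => le0; apply/eqP; rewrite -subr_eq0 -ipBl//.
by rewrite -sqrf_eq0 eq_le le0 sqr_ge0.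
Qed.

Definition nrm f := Num.sqrt (nsq f).

Lemma nrm_triangle f g : L2 P f -> L2 P g -> nrm (f + g) <= nrm f + nrm g.
Proof.
move=> f2 g2; have n0 f' : 0 <= nrm f' by exact: sqrtr_ge0.
rewrite -(@ler_pXn2r _ 2) ?nnegrE ?addr_ge0// sqr_sqrtr ?nsq_ge0//.
have x f' : nrm f' ^+ 2 = nsq f' by rewrite sqr_sqrtr ?nsq_ge0.
suff : ip P f g <= nrm f * nrm g by rewrite sqrrD !x nsqD//; lra.
rewrite (le_trans (ler_norm _))// -(@ler_pXn2r _ 2) ?nnegrE ?mulr_ge0//.
by rewrite exprMn !x real_normK ?num_real// cauchy_schwarz.
Qed.

Lemma nsq_eq0_ae f : L2 P f -> nsq f = 0 -> {ae P, forall w, f w = 0}.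
Proof.
move=> f2 f0; have := ip_sqnorm f2; rewrite -/(nsq f) f0 => i0.
have [mf _] := f2; have msf := measurable_sqnormE mf.
have /(ae_eq_integral_abs P measurableT msf) :
    (\int[P]_w `|(sqnorm (f w))%:E| = 0)%E.
  by rewrite -[RHS]i0; apply: eq_integral => w _; rewrite gee0_abs// lee_fin sqnorm_ge0.
apply: filterS => w /(_ I) [] /sqnorm_eq0; exact.
Qed.

End L2_space.

(** * Projection onto the closure of a space of functions of an observation *)

Section completeness.
Context d d' (T : measurableType d) (V : measurableType d') (R : realType).
Context (P : probability T R) (n : nat).

(** By monotone convergence the sum of the absolute increments has integral at most 2. It is
    therefore finite almost everywhere, and there the telescoping series converges absolutely. *)
Lemma ae_is_cvgn_fast (u : nat -> T -> R) :
  (forall k, measurable_fun setT (u k)) ->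
  (forall k, (\int[P]_w `|u k.+1 w - u k w|%:E <= (2^-1 ^+ k)%:E)%E) ->
  {ae P, forall w, cvgn (u ^~ w)}.
Proof.
move=> mu intu; pose a k w := (`|u k.+1 w - u k w|%:E : \bar R).
have a0 k w : (0 <= a k w)%E by rewrite lee_fin.
have ma k : measurable_fun setT (a k).
  apply/measurable_EFinP; apply: measurableT_comp => //.
  exact: measurable_funB.
have sum_half m : \sum_(0 <= k < m) 2^-1 ^+ k = 2 - 2 * 2^-1 ^+ m :> R.
  elim: m => [|m IH]; first by rewrite big_nil expr0; ring.
  by rewrite big_nat_recr//= IH exprS; field.
have mS : measurable_fun setT (fun w => \sum_(0 <= k <oo) a k w)%E.
  by apply: ge0_emeasurable_sum => // k w _ _; exact: a0.
have iS : P.-integrable setT (fun w => \sum_(0 <= k <oo) a k w)%E.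
  apply/integrableP; split=> //.
  under eq_integral do rewrite gee0_abs ?nneseries_ge0//.
  rewrite integral_nneseries//; apply: (@le_lt_trans _ _ 2%:E); last exact: ltry.
  apply: lime_le.
    by apply: is_cvg_nneseries => k _ _; exact: integral_ge0.
  apply: nearW => m; apply: (@le_trans _ _ (\sum_(0 <= k < m) (2^-1 ^+ k)%:E)%E).
    by apply: lee_sum => k _; exact: intu.
  by rewrite sumEFin lee_fin sum_half lerBlDr lerDl mulr_ge0// exprn_ge0// invr_ge0.
have := integrable_ae measurableT iS; apply: filterS => w /(_ I) Sfin.
have cn : cvgn (series (fun k => `|telescope (u ^~ w) k|)).
  apply: nondecreasing_is_cvgn; first exact: nondecreasing_series.
  exists (fine (\sum_(0 <= k <oo) a k w)%E) => _ [m _ <-].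
  rewrite seriesEnat/= -lee_fin fineK// -sumEFin.
  exact: (@nneseries_lim_ge _ (fun k => a k w)).
have := normed_cvg cn; rewrite telescopeK => cu.
have -> : u ^~ w = (fun k => u k w - u 0%N w) \+ cst (u 0%N w).
  by apply/funext => k /=; rewrite subrK.
by apply: is_cvgD => //; exact: is_cvg_cst.
Qed.

(** The pointwise bound [|x| <= q / 2 + x ^+ 2 / (2 * q)] is integrated against a measure of mass
    one. *)
Lemma integral_abs_coord_le (f : T -> 'rV[R]_n) (q : R) i : 0 < q ->
  L2 P f -> nsq P f <= q ^+ 2 -> (\int[P]_w `|f w ord0 i|%:E <= q%:E)%E.
Proof.
move=> q0 f2 fq; have [mf _] := f2.
have bound w : `|f w ord0 i| <= q / 2 + (2 * q)^-1 * sqnorm (f w).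
  have := coord_sqnorm (f w) i; set x := f w ord0 i; set s := sqnorm _ => xs.
  have -> : q / 2 + (2 * q)^-1 * s = (2 * q)^-1 * (q ^+ 2 + s).
    by field; rewrite gt_eqF.
  rewrite mulrC ler_pdivlMr ?mulr_gt0//.
  have := sqr_ge0 (`|x| - q); have := real_normK (num_real x); nra.
apply: (@le_trans _ _
  (\int[P]_w ((q / 2)%:E + (2 * q)^-1%:E * (sqnorm (f w))%:E))%E).
  apply: ge0_le_integral => //.
  - apply/measurable_EFinP; apply: measurableT_comp => //.
    by move/measurable_rVP : mf.
  - apply: emeasurable_funD => //; apply: emeasurable_funM => //.
    exact: measurable_sqnormE.
  - by move=> w _; rewrite -EFinM -EFinD lee_fin.
have q2 : 0 <= (2 * q)^-1 by rewrite invr_ge0 mulr_ge0// ltW.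
rewrite ge0_integralD//; last 3 first.
- by move=> w _; rewrite lee_fin divr_ge0 ?(ltW q0).
- by move=> w _; rewrite lee_fin mulr_ge0 ?sqnorm_ge0.
- by apply: emeasurable_funM => //; exact: measurable_sqnormE.
rewrite integral_cst// [X in (_ * X + _)%E](_ : _ = 1%E); last first.
  exact: probability_setT.
rewrite mule1 ge0_integralZl_EFin//; last 2 first.
- by move=> w _; rewrite lee_fin sqnorm_ge0.
- exact: measurable_sqnormE.
rewrite ip_sqnorm// -EFinM -EFinD lee_fin.
have : (2 * q)^-1 * ip P f f <= (2 * q)^-1 * q ^+ 2 by exact: ler_wpM2l.
by rewrite (_ : _ * q ^+ 2 = q / 2); [lra|field; rewrite gt_eqF].
Qed.

Lemma limn_einf_le (u : (\bar R)^nat) (b : \bar R) :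
  (forall k, (u k <= b)%E) -> (limn_einf u <= b)%E.
Proof.
move=> ub; rewrite limn_einf_lim; apply: lime_le; first exact: is_cvg_einfs.
by apply: nearW => k; apply: le_trans (ub k); apply: ereal_inf_lbound; exists k => /=.
Qed.

(* The limit is produced as a function of [U], which makes the space of
   square-integrable functions of [U] closed. *)
Lemma L2_complete (U : T -> V) (s : nat -> V -> 'rV[R]_n) :
  measurable_fun setT U ->
  (forall k, measurable_fun setT (s k)) -> (forall k, L2 P (s k \o U)) ->
  (forall k j, (k <= j)%N ->
    nsq P ((s j \o U) - (s k \o U)) <= (2^-1 ^+ k) ^+ 2) ->
  exists m, [/\ measurable_fun setT m, L2 P (m \o U) &
    forall k, nsq P ((m \o U) - (s k \o U)) <= (2^-1 ^+ k) ^+ 2].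
Proof.
move=> mU ms s2 sC.
(* An upper limit is defined and measurable on all of [V], whether or not the sequence converges at
   [v]; infinite values are sent to 0 by [fine]. *)
pose m v : 'rV[R]_n :=
  \row_i fine (limn_esup (fun k => (s k v ord0 i)%:E)).
have mm : measurable_fun setT m.
  apply/measurable_rVP => i; under eq_fun do rewrite mxE.
  apply: measurableT_comp => //.
  apply: (@measurable_fun_limn_esup _ _ _ setT (fun k v => (s k v ord0 i)%:E)) => k.
  by apply/measurable_EFinP; have /measurable_rVP := ms k.
have mmU : measurable_fun setT (m \o U) by exact: measurableT_comp.
have cvg_i i : {ae P, forall w, s k (U w) ord0 i @[k --> \oo] --> m (U w) ord0 i}.
  have : {ae P, forall w, cvgn (fun k => s k (U w) ord0 i)}.
    apply: ae_is_cvgn_fast => k.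
      by have [/measurable_rVP] := s2 k.
    rewrite [leLHS](_ : _ =
        \int[P]_w `|((s k.+1 \o U) - (s k \o U)) w ord0 i|%:E)%E; last first.
      by apply: eq_integral => w _; rewrite coordB.
    apply: integral_abs_coord_le; first by rewrite exprn_gt0// invr_gt0.
    - exact: L2B.
    - exact: sC.
  apply: filterS => w cs; rewrite mxE.
  have /cvg_limn_einf_sup[_ ->]// :
    (s k (U w) ord0 i)%:E @[k --> \oo] --> (limn (fun k => s k (U w) ord0 i))%:E.
  by apply: cvg_EFin; first exact: nearW.
have cvg_m : {ae P, forall w i, s k (U w) ord0 i @[k --> \oo] --> m (U w) ord0 i}.
  exact: filter_forall.
(* Fatou's lemma for [j] tending to infinity, with [k] fixed, carries the Cauchy estimate to the
   limit. *)
have bnd k : (\int[P]_w (sqnorm (((m \o U) - (s k \o U)) w))%:E <=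
    ((2^-1 ^+ k) ^+ 2)%:E)%E.
  pose F j w := (sqnorm (((s (k + j)%N \o U) - (s k \o U)) w))%:E : \bar R.
  have mF j : measurable_fun setT (F j).
    by apply: measurable_sqnormE; have [] := L2B (s2 (k + j)%N) (s2 k).
  apply: (@le_trans _ _ (limn_einf (fun j => \int[P]_w F j w))%E); last first.
    apply: limn_einf_le => j; rewrite ip_sqnorm; last exact: L2B.
    by rewrite lee_fin; apply: sC; rewrite leq_addr.
  apply: le_trans (fatou _ _ _ _) => //; last first.
    by move=> j w _; rewrite lee_fin sqnorm_ge0.
  rewrite le_eqVlt; apply/orP; left; apply/eqP; apply: ae_eq_integral => //.
  - by apply: measurable_sqnormE; apply: measurable_rVB => //; have [] := s2 k.
  - rewrite /limn_einf; apply: measurableT_comp => //.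
    apply: (@measurable_fun_limn_esup _ _ _ setT (fun j w => - F j w)%E) => j.
    exact: measurableT_comp.
  - move: cvg_m; apply: filterS => w cw _.
    have : F j w @[j --> \oo] --> (sqnorm (((m \o U) - (s k \o U)) w))%:E.
      apply: cvg_EFin; first exact: nearW.
      rewrite /sqnorm; apply: cvg_big => //.
        by move=> [x y]; exact: add_continuous.
      move=> i _.
      have ci : s (k + j)%N (U w) ord0 i @[j --> \oo] --> m (U w) ord0 i.
        by have := cw i; rewrite -(cvg_shiftn k); under eq_fun do rewrite addnC.
      rewrite (_ : (fun j => _) = (fun j =>
          (s (k + j)%N (U w) ord0 i - s k (U w) ord0 i) *
          (s (k + j)%N (U w) ord0 i - s k (U w) ord0 i))); last first.
        by apply/funext => j; rewrite coordB expr2.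
      by rewrite coordB expr2; apply: cvgM; exact: (cvgB ci (cvg_cst _)).
    by move=> /cvg_limn_einf_sup[].
have m2 k : L2 P ((m \o U) - (s k \o U)).
  split; last exact: le_lt_trans (bnd k) (ltry _).
  by apply: measurable_rVB => //; have [] := s2 k.
exists m; split=> // [|k]; last by rewrite -lee_fin -ip_sqnorm.
by rewrite -(subrK (s 0%N \o U) (m \o U)); apply: L2D.
Qed.

End completeness.

Lemma half_small (R : realType) (e : R) : 0 < e -> exists k, 2^-1 ^+ k < e.
Proof.
move=> e0; have /cvgrPdist_lt/(_ e e0)[k _ /(_ k (leqnn k))] :
    geometric 1 2^-1 @ \oo --> (0 : R).
  by apply: cvg_geometric; rewrite ger0_norm ?invr_ge0// invf_lt1// ltr1n.
rewrite /= sub0r mul1r normrN ger0_norm ?exprn_ge0 ?invr_ge0// => ke.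
by exists k.
Qed.

Section projection.
Context d d' (T : measurableType d) (V : measurableType d') (R : realType).
Context (P : probability T R) (n : nat).
Context (U : T -> V) (mU : measurable_fun setT U).
Context (S : set (V -> 'rV[R]_n)).
Hypotheses (S0 : S 0) (SD : forall a u v, S u -> S v -> S (a *: u + v)).
Hypothesis mS : forall u, S u -> measurable_fun setT u.
Hypothesis S2 : forall u, S u -> L2 P (u \o U).

(** A minimizing sequence in [S] is Cauchy by the parallelogram law. Since [S] need not be closed,
    the limit [m] may lie outside it; the last clause records that [m] is in the closure. *)
Lemma L2_projection (Z : T -> 'rV[R]_n) : L2 P Z ->
  exists m, [/\ measurable_fun setT m, L2 P (m \o U),
    forall h, S h -> ip P (Z - (m \o U)) (h \o U) = 0 &
    forall e, 0 < e -> exists2 s, S s & nsq P ((m \o U) - (s \o U)) <= e].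
Proof.
move=> Z2; pose D := [set nsq P (Z - (s \o U)) | s in S].
have D0 : has_lbound D by exists 0 => _ [s _ <-]; exact: nsq_ge0.
have Dinf : has_inf D by split => //; exists (nsq P (Z - (0 \o U))), 0.
have infD s : S s -> inf D <= nsq P (Z - (s \o U)).
  by move=> Ss; apply: ge_inf => //; exists s.
have infD0 : 0 <= inf D by apply: lb_le_inf; [case: Dinf|move=> _ [s _ <-]; exact: nsq_ge0].
have q0 k : 0 < 2^-1 ^+ k :> R by rewrite exprn_gt0// invr_gt0.
(* The slack is chosen so that the parallelogram law yields exactly the rate required by
   [L2_complete]. *)
have ex_s k : exists s, S s /\ nsq P (Z - (s \o U)) < inf D + (2^-1 ^+ k) ^+ 2 / 4.
  have e0 : 0 < (2^-1 ^+ k) ^+ 2 / 4 :> R by rewrite divr_gt0// exprn_gt0.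
  by have [_ [s Ss <-] sD] := inf_adherent e0 Dinf; exists s.
have [s sP] := choice ex_s.
have Ss k : S (s k) by have [] := sP k.
have s2 k : L2 P (s k \o U) by exact: S2.
have zs2 k : L2 P (Z - (s k \o U)) by exact: L2B.
have sC k j : (k <= j)%N -> nsq P ((s j \o U) - (s k \o U)) <= (2^-1 ^+ k) ^+ 2.
  (* The midpoint is a competitor in [S], so its distance to [Z] is bounded below by [inf D]. *)
  move=> kj; have Sh : S (2^-1 *: s j + 2^-1 *: s k).
    by apply: SD => //; rewrite -[_ *: s k]addr0; apply: SD.
  have := parallelogram (zs2 k) (zs2 j).
  have -> : Z - (s k \o U) - (Z - (s j \o U)) = (s j \o U) - (s k \o U).
    by rewrite opprB addrC addrA subrK.
  have -> : Z - (s k \o U) + (Z - (s j \o U)) =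
      2 *: (Z - ((2^-1 *: s j + 2^-1 *: s k) \o U)).
    have -> : (2^-1 *: s j + 2^-1 *: s k) \o U =
        2^-1 *: ((s j \o U) + (s k \o U)).
      by rewrite scalerDr.
    rewrite scalerBr scalerA divff// scale1r scaler_nat mulr2n opprD addrACA.
    by congr (_ + _); rewrite addrC.
  rewrite nsqZ; last exact: L2B (S2 Sh).
  have := infD _ Sh; have [_] := sP k; have [_] := sP j.
  have : (2^-1 ^+ j) ^+ 2 <= (2^-1 ^+ k) ^+ 2 :> R.
    suff : 2^-1 ^+ j <= 2^-1 ^+ k :> R.
      by have := q0 j; have := q0 k; nra.
    by apply: ler_wiXn2l; rewrite // ?invr_ge0// invf_le1// ler1n.
  have -> : 2 ^+ 2 = 4 :> R by rewrite expr2; ring.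
  lra.
have [m [mm m2 mC]] := L2_complete mU (fun k => mS (Ss k)) s2 sC.
exists m; split=> //.
- move=> h Sh; have h2 := S2 Sh; apply: ip_eq0_of_min => //; first exact: L2B.
  have half_cvg (a b : R) : (forall k, a <= b + 2 * 2^-1 ^+ k) -> a <= b.
    move=> ab; apply/ler_addgt0Pr => e e0.
    have [k ke] : exists k, 2^-1 ^+ k < e / 2 :> R by apply: half_small; lra.
    by have := ab k; lra.
  have nm k : nrm P ((m \o U) - (s k \o U)) <= 2^-1 ^+ k.
    by rewrite -(@ler_pXn2r _ 2) ?nnegrE ?sqrtr_ge0 ?(ltW (q0 k))// sqr_sqrtr ?nsq_ge0.
  have nm' k : nrm P ((s k \o U) - (m \o U)) <= 2^-1 ^+ k.
    by rewrite /nrm -opprB nsqN; exact: nm.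
  (* The function [t *: h + s k] belongs to [S], and replacing [s k] by [m] costs at most
     [2^-1 ^+ k]. *)
  have lower t : Num.sqrt (inf D) <= nrm P (Z - (m \o U) - t *: (h \o U)).
    apply: half_cvg => k.
    have Sk : S (t *: h + s k) by exact: SD.
    have : Num.sqrt (inf D) <= nrm P (Z - ((t *: h + s k) \o U)).
      by apply: ler_wsqrtr; exact: infD.
    have -> : Z - ((t *: h + s k) \o U) =
        Z - (m \o U) - t *: (h \o U) + ((m \o U) - (s k \o U)).
      rewrite (_ : (_ + _) \o U = t *: (h \o U) + (s k \o U))//.
      by rewrite opprD addrA [RHS]addrA (addrAC _ (- (m \o U))) subrK.
    move=> /le_trans; apply.
    have zmh : L2 P (Z - (m \o U) - t *: (h \o U)).
      by apply: L2B; [exact: L2B|exact: L2Z].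
    apply: le_trans (nrm_triangle zmh (L2B m2 (s2 k))) _.
    by have := nm k; have := q0 k; lra.
  have upper : nrm P (Z - (m \o U)) <= Num.sqrt (inf D).
    apply: half_cvg => k.
    rewrite (_ : Z - (m \o U) = Z - (s k \o U) + ((s k \o U) - (m \o U))).
      apply: le_trans (nrm_triangle (zs2 k) (L2B (s2 k) m2)) _.
      suff : nrm P (Z - (s k \o U)) <= Num.sqrt (inf D) + 2^-1 ^+ k.
        by have := nm' k; lra.
      rewrite -(@ler_pXn2r _ 2) ?nnegrE ?addr_ge0 ?sqrtr_ge0 ?(ltW (q0 k))//.
      rewrite sqr_sqrtr ?nsq_ge0// sqrrD sqr_sqrtr//.
      have [_] := sP k; have := sqr_ge0 (2^-1 ^+ k : R).
      have : 0 <= Num.sqrt (inf D) * 2^-1 ^+ k by rewrite mulr_ge0 ?sqrtr_ge0 ?ltW.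
      lra.
    by rewrite addrA subrK.
  move=> t; have := le_trans upper (lower t).
  by rewrite ler_sqrt// nsq_ge0.
- move=> e e0; have [k ke] := half_small e0.
  exists (s k) => //; apply: le_trans (mC k) _.
  have q1 : 2^-1 ^+ k <= 1 :> R by rewrite exprn_ile1// ?invr_ge0// invf_le1// ler1n.
  by have := q0 k; nra.
Qed.

End projection.

(** * Change of variables along a measurable map *)

Section transfer.
Context d d' (T : measurableType d) (T' : measurableType d') (R : realType).
Context (P : probability T R) (P' : probability T' R) (n : nat) (h : T -> T').
Hypothesis mh : measurable_fun setT h.
Hypothesis P'E : forall C, measurable C -> P (h @^-1` C) = P' C.

Lemma transfer_ge0_integral (f : T' -> \bar R) :
  measurable_fun setT f -> (forall y, (0 <= f y)%E) ->
  (\int[P']_y f y = \int[P]_x f (h x))%E.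
Proof.
move=> mf f0; rewrite -(@ge0_integral_pushforward _ _ _ _ _ h mh P setT f)//.
by apply: eq_measure_integral => C mC _; exact/esym/P'E.
Qed.

Lemma transfer_L2 (f : T' -> 'rV[R]_n) : measurable_fun setT f ->
  L2 P' f <-> L2 P (f \o h).
Proof.
move=> mf; have mfh := measurableT_comp mf mh.
rewrite /L2 transfer_ge0_integral//; first by split=> -[].
  exact: measurable_sqnormE.
by move=> y; rewrite lee_fin sqnorm_ge0.
Qed.

Lemma transfer_ip (f g : T' -> 'rV[R]_n) : L2 P' f -> L2 P' g ->
  ip P' f g = ip P (f \o h) (g \o h).
Proof.
move=> f2 g2; have [mf _] := f2; have [mg _] := g2.
have fh2 := (transfer_L2 mf).1 f2; have gh2 := (transfer_L2 mg).1 g2.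
rewrite /ip /Rintegral; congr fine.
rewrite (@eq_measure_integral _ _ _ _ (pushforward P h)); last first.
  by move=> C mC _; exact/esym/P'E.
rewrite (@integral_pushforward _ _ _ _ _ h mh P setT)//.
  by apply/measurable_EFinP; exact: measurable_dotv.
exact: integrable_dotv fh2 gh2.
Qed.

Lemma transfer_nsq (f : T' -> 'rV[R]_n) : L2 P' f ->
  nsq P' f = nsq P (f \o h).
Proof. by move=> f2; exact: transfer_ip. Qed.

End transfer.

(** * Conditional expectation as least-squares regression *)

Section ae_equality.
Context d (T : measurableType d) (R : realType) (P : probability T R) (n : nat).
Implicit Types f g : T -> 'rV[R]_n.

Lemma L2_ae f g : measurable_fun setT f -> L2 P g ->
  {ae P, forall w, f w = g w} -> L2 P f.
Proof.
move=> mf [mg goo] fg; split=> //.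
rewrite (ae_eq_integral (fun w => (sqnorm (g w))%:E)) ?goo//.
- exact: measurable_sqnormE.
- exact: measurable_sqnormE.
- by apply: filterS fg => w /= ->.
Qed.

Lemma nsqB_ae f g : L2 P f -> L2 P g -> {ae P, forall w, f w = g w} ->
  nsq P (f - g) = 0.
Proof.
move=> f2 g2 fg; apply: EFin_inj; rewrite -ip_sqnorm; last exact: L2B.
have [m _] := L2B f2 g2; rewrite -[RHS](integral0 P setT).
apply: ae_eq_integral => //; first exact: measurable_sqnormE.
apply: filterS fg => w /= fgw _; rewrite !fctE fgw subrr /sqnorm big1// => i _.
by rewrite mxE expr0n.
Qed.

Lemma nsqB_eq0_ae f g : L2 P f -> L2 P g -> nsq P (f - g) = 0 ->
  {ae P, forall w, f w = g w}.
Proof.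
move=> f2 g2 /(nsq_eq0_ae (L2B f2 g2)); apply: filterS => w /eqP.
by rewrite !fctE subr_eq0 => /eqP.
Qed.

End ae_equality.

Section regression.
Context d (T : measurableType d) (R : realType) (P : probability T R) (m n : nat).
Context (X : T -> 'rV[R]_m) (mX : measurable_fun setT X).
Implicit Types (Z : T -> 'rV[R]_n) (g h : 'rV[R]_m -> 'rV[R]_n).

(** The Hilbert-space form of conditional expectation: test events are replaced by all
    square-integrable functions of [X]. *)
Definition L2_regression Z g :=
  [/\ measurable_fun setT g, L2 P (g \o X) &
    forall h, measurable_fun setT h -> L2 P (h \o X) ->
      ip P (Z - (g \o X)) (h \o X) = 0].

(** Projection onto the space of all square-integrable functions of [X]. *)
Lemma L2_regression_exists Z : L2 P Z -> exists g, L2_regression Z g.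
Proof.
move=> Z2; pose S := [set h : 'rV[R]_m -> 'rV[R]_n |
  measurable_fun setT h /\ L2 P (h \o X)].
have [||u []//|u []//|g [mg g2 orth _]] := L2_projection mX (S := S) _ _ _ _ Z2.
- by split; [exact: measurable_rV0|exact: L2_0].
- move=> a u v [mu u2] [mv v2]; split.
    by apply: measurable_rVD => //; exact: measurable_rVZ.
  by apply: L2D => //; exact: L2Z.
by exists g; split=> // h mh h2; exact: orth.
Qed.

Lemma dotv_delta (u : 'rV[R]_n) a i : dotv u (a *: delta_mx ord0 i) = a * u ord0 i.
Proof.
rewrite /dotv (bigD1 i)//= big1 ?addr0 => [|j ji].
  by rewrite !mxE !eqxx mulr1 mulrC.
by rewrite !mxE (negbTE ji) andbF !mulr0.
Qed.

Lemma integrable_coord Z i : L2 P Z ->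
  P.-integrable setT (fun w => (Z w ord0 i)%:E).
Proof.
move=> Z2; have b2 : L2 P (cst (1 *: delta_mx ord0 i) : T -> 'rV[R]_n).
  by apply: (@L2_bounded _ _ _ _ _ _ (sqnorm (1 *: delta_mx ord0 i))).
apply: eq_integrable (integrable_dotv Z2 b2) => // w _.
by rewrite /= dotv_delta mul1r.
Qed.

(** The test function is the indicator of [C] times the [i]-th basis vector; it links the defining
    set integrals of [is_cond_exp] to orthogonality. *)
Lemma integral_preimage_coord Z i C : measurable C -> L2 P Z ->
  exists h, [/\ measurable_fun setT h, L2 P (h \o X) &
   (\int[P]_(w in X @^-1` C) (Z w ord0 i)%:E = (ip P Z (h \o X))%:E)%E].
Proof.
move=> mC Z2.
pose h (v : 'rV[R]_m) : 'rV[R]_n := (\1_C v : R) *: delta_mx ord0 i.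
have mh : measurable_fun setT h.
  apply/measurable_rVP => j; rewrite (_ : (fun _ => _) =
      (fun v => (\1_C v : R) * (delta_mx ord0 i : 'rV[R]_n) ord0 j)).
    by apply: measurable_funM => //; exact: measurable_indic.
  by apply/funext => v; rewrite mxE.
have h2 : L2 P (h \o X).
  apply: (@L2_bounded _ _ _ _ _ _ (sqnorm (delta_mx ord0 i : 'rV[R]_n))).
    exact: measurableT_comp.
  have C1 v : (\1_C v : R) ^+ 2 <= 1.
    by rewrite indicE; case: (v \in C); rewrite ?expr1n ?expr0n.
  by move=> w; rewrite /= sqnormZ; apply: ler_piMl; [exact: sqnorm_ge0|exact: C1].
exists h; split=> //.
rewrite /ip /Rintegral fineK; last exact: (integrable_fin_num _ (integrable_dotv Z2 h2)).
rewrite [LHS]integral_mkcond; apply: eq_integral => w _.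
rewrite /= dotv_delta patchE indicE.
by rewrite (_ : (w \in _) = (X w \in C))//; case: ifP; rewrite ?mul1r ?mul0r.
Qed.

Lemma L2_regression_is_cond_exp Z g : L2 P Z -> L2_regression Z g ->
  is_cond_exp P X Z g.
Proof.
move=> Z2 [mg g2 orth]; split=> // i; split.
- exact: integrable_coord.
- exact: (integrable_coord i g2).
move=> C mC; have [h [mh h2 E]] := integral_preimage_coord i mC (L2B Z2 g2).
have := E; rewrite orth// => {}E.
have mXC : measurable (X @^-1` C) by rewrite -[X in measurable X]setTI; exact: mX.
have iZ := integrableS measurableT mXC (@subsetT _ _) (integrable_coord i Z2).
have ig := integrableS measurableT mXC (@subsetT _ _) (integrable_coord i g2).
have : (\int[P]_(w in X @^-1` C) ((Z w ord0 i)%:E - (g (X w) ord0 i)%:E) = 0%:E)%E.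
  by rewrite -E; apply: eq_integral => w _; rewrite coordB.
rewrite integralB//.
move: (integrable_fin_num mXC iZ) (integrable_fin_num mXC ig).
by move=> Zf gf /eqP; rewrite sube_eq ?add0e ?gf ?Zf// ?fin_num_adde_defl// => /eqP ->.
Qed.

Lemma is_cond_exp_unique Z g g' : is_cond_exp P X Z g -> is_cond_exp P X Z g' ->
  {ae P, forall w, g (X w) = g' (X w)}.
Proof.
move=> [mg gE] [mg' g'E].
suff : {ae P, forall w i, g (X w) ord0 i = g' (X w) ord0 i}.
  by apply: filterS => w e; apply/rowP.
apply: filter_forall => i.
have [_ ig gC] := gE i; have [_ ig' g'C] := g'E i.
have mcoord (u : 'rV[R]_m -> 'rV[R]_n) : measurable_fun setT u ->
    measurable_fun setT (fun v : 'rV[R]_m => (u v ord0 i : R)%:E).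
  by move=> /measurable_rVP mu; apply/measurable_EFinP.
pose PX : probability _ R := distribution P
  (HB.pack_for {mfun T >-> 'rV[R]_m} X (isMeasurableFun.Build _ _ _ _ X mX)).
have pf (u : 'rV[R]_m -> 'rV[R]_n) C : measurable_fun setT u -> measurable C ->
    P.-integrable setT (fun w => (u (X w) ord0 i : R)%:E) ->
    (\int[PX]_(v in C) (u v ord0 i)%:E =
     \int[P]_(w in X @^-1` C) (u (X w) ord0 i)%:E)%E.
  move=> mu mC iu.
  have mXC : measurable (X @^-1` C) by rewrite -[X in measurable X]setTI; exact: mX.
  exact: (@integral_pushforward _ _ _ _ _ X mX P C _ (mcoord _ mu)
    (integrableS measurableT mXC (@subsetT _ _) iu) mC).
have [A [mA A0 sub]] : ae_eq PX setT
    (fun v => (g v ord0 i)%:E) (fun v => (g' v ord0 i)%:E).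
  apply: integral_ae_eq => //.
  - exact: (integrable_pushforward mX (mcoord _ mg) ig).
  - exact: mcoord.
  - by move=> C _ mC; rewrite !pf// gC// g'C.
exists (X @^-1` A); split=> //.
  by rewrite -[X in measurable X]setTI; exact: mX.
by move=> w /= ne; apply: sub => /= e; apply: ne; have [] := e I.
Qed.

Lemma L2_regression_unique Z g g' : L2 P Z ->
  L2_regression Z g -> L2_regression Z g' -> nsq P ((g \o X) - (g' \o X)) = 0.
Proof.
move=> Z2 rg rg'; have [_ g2 _] := rg; have [_ g'2 _] := rg'.
apply: nsqB_ae => //.
by apply: (@is_cond_exp_unique Z); exact: L2_regression_is_cond_exp.
Qed.

(** The projection is a version, so the chosen function is one as well rather than the default. It
    agrees almost surely with the projection and inherits its integrability and orthogonality. *)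
Lemma cond_exp_L2_regression Z : L2 P Z -> L2_regression Z (cond_exp P X Z).
Proof.
move=> Z2; have [g rg] := L2_regression_exists Z2.
have gE := L2_regression_is_cond_exp Z2 rg.
have cE : is_cond_exp P X Z (cond_exp P X Z).
  by rewrite /cond_exp; case: xgetP => [f _ //|/(_ g)].
have [mg g2 orth] := rg; have [mc _] := cE.
have ae := is_cond_exp_unique cE gE.
have c2 : L2 P (cond_exp P X Z \o X) by apply: L2_ae ae => //; exact: measurableT_comp.
split=> // h mh h2.
have := orth h mh h2; rewrite !ipBl// => /eqP; rewrite subr_eq0 => /eqP ->.
by rewrite (ip_null c2 g2 h2) ?subrr// nsqB_ae.
Qed.

Lemma L2_regression_congr Z Z' g : L2 P Z -> L2 P Z' -> nsq P (Z - Z') = 0 ->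
  L2_regression Z g -> L2_regression Z' g.
Proof.
move=> Z2 Z'2 ZZ' [mg g2 orth]; split=> // h mh h2.
by have := orth h mh h2; rewrite !ipBl// (ip_null Z2 Z'2 h2).
Qed.

(* Pythagoras: the residual [Z - g \o X] is orthogonal to [g \o X - r \o X]. *)
Lemma nsq_regret Z g r : L2 P Z -> L2_regression Z g ->
  measurable_fun setT r -> L2 P (r \o X) ->
  nsq P (Z - (r \o X)) = nsq P (Z - (g \o X)) + nsq P ((g \o X) - (r \o X)).
Proof.
move=> Z2 [mg g2 orth] mr r2; have Zg2 := L2B Z2 g2; have gr2 := L2B g2 r2.
have -> : Z - (r \o X) = (Z - (g \o X)) + ((g \o X) - (r \o X)).
  by rewrite addrA subrK.
rewrite nsqD// (orth (g - r)) ?mulr0 ?addr0//.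
exact: measurable_rVB.
Qed.

End regression.

(** * Feasible laws and their reflections *)

Section mse.
Context (R : realType) (M1 M2 N : nat).
Local Notation obs := ('rV[R]_M1 * 'rV[R]_M2)%type.
Local Notation joint := (obs * 'rV[R]_N)%type.
Local Notation X1 := (@X1 R M1 M2 N).
Local Notation X2 := (@X2 R M1 M2 N).
Local Notation X12 := (@X12 R M1 M2 N).
Local Notation Y := (@Y R M1 M2 N).
Implicit Types (P : probability joint R) (f : obs -> 'rV[R]_N).

Lemma measurable_X12 : measurable_fun setT X12.
Proof. exact: measurable_fst. Qed.

Lemma measurable_X1 : measurable_fun setT X1.
Proof. exact: measurableT_comp measurable_fst measurable_fst. Qed.

Lemma measurable_X2 : measurable_fun setT X2.
Proof. exact: measurableT_comp measurable_snd measurable_fst. Qed.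

Lemma measurable_Y : measurable_fun setT Y.
Proof. exact: measurable_snd. Qed.

Lemma mse_L2 P V (U : joint -> V) rho : L2 P (Y - (rho \o U)) ->
  mse P U rho = (nsq P (Y - (rho \o U)))%:E.
Proof. by move=> h; rewrite -ip_sqnorm// /mse expectation.unlock. Qed.

Lemma mse_ltyP P d (V : measurableType d) (U : joint -> V) rho :
  measurable_fun setT U -> measurable_fun setT rho -> L2 P Y ->
  (mse P U rho < +oo)%E <-> L2 P (rho \o U).
Proof.
move=> mU mrho Y2; split=> [fin|rho2].
  have D2 : L2 P (Y - (rho \o U)).
    split; last by move: fin; rewrite /mse expectation.unlock.
    by apply: measurable_rVB; [exact: measurable_Y|exact: measurableT_comp].
  by have := L2B Y2 D2; rewrite opprB addrC subrK.
by rewrite mse_L2 ?ltry//; exact: L2B.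
Qed.

(** Candidates are merely measurable; those that are not square-integrable have infinite risk. *)
Lemma mse_pinfty P d (V : measurableType d) (U : joint -> V) rho :
  measurable_fun setT U -> measurable_fun setT rho -> L2 P Y ->
  ~ L2 P (rho \o U) -> mse P U rho = +oo%E.
Proof.
move=> mU mrho Y2 nrho; apply/eqP; rewrite -leye_eq leNgt; apply/negP.
by move/(mse_ltyP mU mrho Y2).
Qed.

(** The zero function has finite risk, hence so does the minimizer. Moving it by [t *: h] stays in
    the subspace, and first-order optimality gives orthogonality. *)
Lemma argmin_mse_orthogonal P d (V : measurableType d) (U : joint -> V)
    (D : set (V -> 'rV[R]_N)) phi :
  measurable_fun setT U -> L2 P Y -> submod_closed (mem D) ->
  (forall h, D h -> measurable_fun setT h) -> argmin D (mse P U) phi ->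
  L2 P (phi \o U) /\
  forall h, D h -> L2 P (h \o U) -> ip P (Y - (phi \o U)) (h \o U) = 0.
Proof.
move=> mU Y2 [D0 Dlin] mD [Dphi phimin].
have D0' : D 0 by move: D0; rewrite inE.
have phi2 : L2 P (phi \o U).
  apply/(mse_ltyP mU (mD _ Dphi) Y2); apply: le_lt_trans (phimin _ D0') _.
  by apply/(mse_ltyP mU (mD _ D0') Y2); exact: L2_0.
split=> // h Dh h2; apply: ip_eq0_of_min => //; first exact: L2B.
move=> t; have Dt : D (t *: h + phi).
  by have := Dlin t h phi; rewrite !inE; apply.
have := phimin _ Dt.
have th2 : L2 P ((t *: h + phi) \o U) by exact: L2D (L2Z t h2) phi2.
rewrite !mse_L2; [|exact: L2B|exact: L2B].
rewrite lee_fin (_ : Y - ((t *: h + phi) \o U) =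
  Y - (phi \o U) - t *: (h \o U))//.
rewrite (_ : (t *: h + phi) \o U = t *: (h \o U) + (phi \o U))//.
by rewrite opprD addrA addrAC.
Qed.

(** The observations are kept and [Y] is reflected through the point [m (X1, X2)]. *)
Definition mirror (m : obs -> 'rV[R]_N) (w : joint) : joint :=
  (w.1, (2 : R) *: m w.1 - w.2).

Lemma measurable_mirror m : measurable_fun setT m ->
  measurable_fun setT (mirror m).
Proof.
move=> mm; apply: measurable_fun_pair => /=; first exact: measurable_fst.
apply: measurable_rVB; last exact: measurable_snd.
apply: measurable_rVZ; exact: measurableT_comp mm measurable_fst.
Qed.

Lemma mirror_law m P : measurable_fun setT m -> exists P' : probability joint R,
  forall C, measurable C -> P (mirror m @^-1` C) = P' C.
Proof.
move=> mm; exists (distribution P (HB.pack_for {mfun joint >-> joint} (mirror m)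
  (isMeasurableFun.Build _ _ _ _ (mirror m) (measurable_mirror mm)))).
by [].
Qed.

(** The original residual is the sum of the same two terms, so the residuals under a law and its
    reflection are the two diagonals of a parallelogram. *)
Lemma residual_mirror m f : (Y - (f \o X12)) \o mirror m =
  ((m \o X12) - (f \o X12)) - (Y - (m \o X12)).
Proof.
have E (a b y : 'rV[R]_N) : (2 : R) *: a - y - b = a - b - (y - a).
  by rewrite scaler_nat mulr2n opprB addrACA addrA addrAC.
by apply/funext => w; exact: E.
Qed.

End mse.

(** * The center of the feasible class and the multi-domain estimator *)

Section minimax.
Context (R : realType) (M1 M2 N : nat).
Local Notation obs := ('rV[R]_M1 * 'rV[R]_M2)%type.
Local Notation joint := (obs * 'rV[R]_N)%type.
Local Notation X1 := (@X1 R M1 M2 N).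
Local Notation X2 := (@X2 R M1 M2 N).
Local Notation X12 := (@X12 R M1 M2 N).
Local Notation Y := (@Y R M1 M2 N).
Context (A : set ('rV[R]_M1 -> 'rV[R]_N)) (B : set ('rV[R]_M2 -> 'rV[R]_N)).
Hypotheses (A_sub : submod_closed (mem A)) (B_sub : submod_closed (mem B)).
Hypothesis A_meas : forall phi, A phi -> measurable_fun setT phi.
Hypothesis B_meas : forall psi, B psi -> measurable_fun setT psi.
Context (phiA : 'rV[R]_M1 -> 'rV[R]_N) (psiB : 'rV[R]_M2 -> 'rV[R]_N).
Context (P12 : probability ('rV[R]_M1 * 'rV[R]_M2)%type R) (c : R).
Let F := feasible A B phiA psiB P12 c.
Implicit Types (P Q : probability joint R) (f m : obs -> 'rV[R]_N).

Lemma feasible_Y P : F P -> L2 P Y /\ nsq P Y = c.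
Proof.
case=> _ _ _; rewrite expectation.unlock => Yc.
have Y2 : L2 P Y by split; [exact: measurable_Y|rewrite Yc ltry].
by split=> //; apply: EFin_inj; rewrite -ip_sqnorm// Yc.
Qed.

Lemma feasible_X12 P : F P ->
  forall C, measurable C -> P (X12 @^-1` C) = P12 C.
Proof. by case. Qed.

Lemma L2_X12 P f : F P -> measurable_fun setT f -> L2 P12 f <-> L2 P (f \o X12).
Proof.
by move=> FP; exact: (transfer_L2 (@measurable_X12 R M1 M2 N) (feasible_X12 FP)).
Qed.

Lemma ip_X12 P f f' : F P -> L2 P12 f -> L2 P12 f' ->
  ip P12 f f' = ip P (f \o X12) (f' \o X12).
Proof.
by move=> FP; exact: (transfer_ip (@measurable_X12 R M1 M2 N) (feasible_X12 FP)).
Qed.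

(** Members of [A] and [B] need not be square-integrable. Each summand is required to be, so that
    its pairing with [Y] can be treated separately. *)
Definition L2_sum : set (obs -> 'rV[R]_N) := [set u | exists phi psi,
  [/\ A phi, B psi, L2 P12 (phi \o fst), L2 P12 (psi \o snd) &
      u = (phi \o fst) + (psi \o snd)]].

Lemma L2_sum_L2 u : L2_sum u -> L2 P12 u.
Proof. by move=> [phi [psi [_ _ phi2 psi2 ->]]]; exact: L2D. Qed.

Lemma L2_sum_fst phi : A phi -> L2 P12 (phi \o fst) -> L2_sum (phi \o fst).
Proof.
move=> Aphi phi2; exists phi, 0; split=> //.
- by have [] := B_sub; rewrite inE.
- exact: L2_0.
- by apply/funext => w; rewrite !fctE /= addr0.
Qed.

Lemma L2_sum_snd psi : B psi -> L2 P12 (psi \o snd) -> L2_sum (psi \o snd).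
Proof.
move=> Bpsi psi2; exists 0, psi; split=> //.
- by have [] := A_sub; rewrite inE.
- exact: L2_0.
- by apply/funext => w; rewrite !fctE /= add0r.
Qed.

Lemma L2_sum_lin a u v : L2_sum u -> L2_sum v -> L2_sum (a *: u + v).
Proof.
move=> [phi [psi [Aphi Bpsi phi2 psi2 ->]]].
move=> [phi' [psi' [Aphi' Bpsi' phi2' psi2' ->]]].
exists (a *: phi + phi'), (a *: psi + psi'); split.
- by have [_ /(_ a phi phi')] := A_sub; rewrite !inE; apply.
- by have [_ /(_ a psi psi')] := B_sub; rewrite !inE; apply.
- exact: L2D (L2Z a phi2) phi2'.
- exact: L2D (L2Z a psi2) psi2'.
- rewrite scalerDr addrACA//.
Qed.

(* The pairing of [Y] with [A] and [B] is prescribed by [phiA], [psiB] and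
   the law of [(X1, X2)], hence is the same for all feasible laws. *)
Lemma feasible_ip P Q u : F P -> F Q -> L2_sum u ->
  ip P Y (u \o X12) = ip Q Y (u \o X12).
Proof.
move=> FP FQ [phi [psi [Aphi Bpsi phi2 psi2 ->]]].
suff E P' : F P' -> ip P' Y (((phi \o fst) + (psi \o snd)) \o X12) =
    ip P12 (phiA \o fst) (phi \o fst) + ip P12 (psiB \o snd) (psi \o snd).
  by rewrite !E.
move=> FP'; have [Y2 _] := feasible_Y FP'.
have [argA argB _ _] := FP'.
have [phiA2 oA] :=
  argmin_mse_orthogonal (@measurable_X1 R M1 M2 N) Y2 A_sub A_meas argA.
have [psiB2 oB] :=
  argmin_mse_orthogonal (@measurable_X2 R M1 M2 N) Y2 B_sub B_meas argB.
have mphi : measurable_fun setT (phi \o fst : obs -> _) by case: phi2.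
have mpsi : measurable_fun setT (psi \o snd : obs -> _) by case: psi2.
have phi2' : L2 P' (phi \o X1) := (L2_X12 FP' mphi).1 phi2.
have psi2' : L2 P' (psi \o X2) := (L2_X12 FP' mpsi).1 psi2.
have mphiA : measurable_fun setT (phiA \o fst : obs -> _).
  by apply: measurableT_comp => //; apply: A_meas; case: argA.
have mpsiB : measurable_fun setT (psiB \o snd : obs -> _).
  by apply: measurableT_comp => //; apply: B_meas; case: argB.
rewrite (ip_X12 FP' _ phi2); last exact/(L2_X12 FP' mphiA).
rewrite (ip_X12 FP' _ psi2); last exact/(L2_X12 FP' mpsiB).
rewrite [LHS](_ : _ = ip P' Y ((phi \o X1) + (psi \o X2)))// ipDr//.
have := oA _ Aphi phi2'; rewrite ipBl// => /eqP; rewrite subr_eq0 => /eqP ->.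
by have := oB _ Bpsi psi2'; rewrite ipBl// => /eqP; rewrite subr_eq0 => /eqP ->.
Qed.

(** Orthogonality holds under all feasible laws at once. Orthogonality to [m] itself is a separate
    clause because [m] may lie only in the closure of [L2_sum]. *)
Definition center m := [/\ measurable_fun setT m, L2 P12 m &
  forall P, F P ->
    (forall u, L2_sum u -> ip P (Y - (m \o X12)) (u \o X12) = 0) /\
    ip P (Y - (m \o X12)) (m \o X12) = 0].

(** [Y] is projected under one feasible law [P0]. By [feasible_ip] the residual is orthogonal to
    [L2_sum] under every feasible law, and approximation extends this to [m], since distances
    between functions of the observations depend only on [P12]. *)
Lemma center_exists : F !=set0 -> exists m, center m.
Proof.
move=> [P0 FP0]; have [Y2 _] := feasible_Y FP0.
have S0 : L2_sum 0.
  have A0 : A 0 by have [] := A_sub; rewrite inE.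
  exact: (L2_sum_fst A0 (@L2_0 _ _ _ P12 N)).
have mS u : L2_sum u -> measurable_fun setT u by move=> /L2_sum_L2[].
have S2 P u : F P -> L2_sum u -> L2 P (u \o X12).
  by move=> FP Su; apply/(L2_X12 FP (mS _ Su)); exact: L2_sum_L2.
have [m [mm m2 orth dense]] :=
  L2_projection (@measurable_X12 R M1 M2 N) S0 L2_sum_lin mS
    (fun u => S2 P0 u FP0) Y2.
have m12 : L2 P12 m by exact/(L2_X12 FP0 mm).
exists m; split=> // P FP; have [YP2 _] := feasible_Y FP.
have mP : L2 P (m \o X12) by exact/(L2_X12 FP mm).
have YmP : L2 P (Y - (m \o X12)) by exact: L2B.
have orthP u : L2_sum u -> ip P (Y - (m \o X12)) (u \o X12) = 0.
  move=> Su; have u2 := S2 _ _ FP Su; have u20 := S2 _ _ FP0 Su.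
  rewrite -(orth _ Su) !ipBl// (feasible_ip FP FP0 Su).
  by rewrite -(ip_X12 FP)//; [rewrite -(ip_X12 FP0)//|]; exact: L2_sum_L2.
split=> //; apply/eqP; rewrite -sqrf_eq0 eq_le sqr_ge0 andbT.
set K := nsq P (Y - (m \o X12)); have K0 : 0 <= K := nsq_ge0 _ _.
apply/ler_addgt0Pr => e e0; rewrite add0r.
(* An approximation this close makes the Cauchy-Schwarz bound at most [e], also when [K] is 0. *)
have d0 : 0 < e / (K + 1) by rewrite divr_gt0//; lra.
have [s Ss sd] := dense _ d0; have s2 := S2 _ _ FP Ss.
have -> : ip P (Y - (m \o X12)) (m \o X12) =
    ip P (Y - (m \o X12)) ((m \o X12) - (s \o X12)).
  by rewrite ipBr// (orthP s)// subr0.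
apply: le_trans (cauchy_schwarz YmP (L2B mP s2)) _; rewrite -/K.
have ms12 := L2B m12 (L2_sum_L2 Ss).
have -> : nsq P ((m \o X12) - (s \o X12)) = nsq P0 ((m \o X12) - (s \o X12)).
  by have := ip_X12 FP ms12 ms12; rewrite (ip_X12 FP0 ms12 ms12).
apply: (@le_trans _ _ (K * (e / (K + 1)))); first exact: ler_wpM2l.
by rewrite mulrA ler_pdivrMr ?mulrDr; [rewrite mulr1 mulrC lerDl ltW|lra].
Qed.

(** Reflection flips the sign of [Y - m], which is orthogonal to [m] and to the square-integrable
    members of [A] and [B]. The risks of all members of [A] and [B], and of the zero estimator, are
    thus unchanged, which preserves the two optimality conditions and the second moment. *)
Lemma feasible_reflect m P : center m -> F P -> exists P',
  F P' /\ forall C, measurable C -> P (mirror m @^-1` C) = P' C.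
Proof.
move=> [mm m12 mF] FP; have [orth morth] := mF _ FP.
have [P' P'E] := mirror_law P mm; exists P'; split=> //.
have mr := measurable_mirror mm.
have [Y2 Yc] := feasible_Y FP.
have m2 : L2 P (m \o X12) by exact/(L2_X12 FP mm).
have Ym2 := L2B Y2 m2.
have mY := @measurable_Y R M1 M2 N.
have same f : measurable_fun setT f ->
    (L2 P (f \o X12) -> ip P (Y - (m \o X12)) (f \o X12) = 0) ->
    mse P' X12 f = mse P X12 f.
  move=> mf fo; have mfX : measurable_fun setT (f \o X12).
    exact: measurableT_comp mf (@measurable_X12 R M1 M2 N).
  have Y2' : L2 P' Y.
    apply/(transfer_L2 mr P'E mY).
    have := L2B (L2Z 2 m2) Y2; congr (L2 _ _).
  have fL : L2 P' (f \o X12) <-> L2 P (f \o X12) := transfer_L2 mr P'E mfX.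
  (* Without square-integrability both risks are infinite. *)
  have [f2|nf2] := pselect (L2 P (f \o X12)); last first.
    have mX := @measurable_X12 R M1 M2 N.
    by rewrite (mse_pinfty mX mf Y2 nf2) (mse_pinfty mX mf Y2')// => /(iffLR fL).
  have f2' := iffRL fL f2.
  rewrite !mse_L2//; [|exact: L2B|exact: L2B].
  congr EFin; rewrite (transfer_nsq mr P'E); last exact: L2B.
  rewrite residual_mirror.
  have -> : Y - (f \o X12) = (m \o X12) - (f \o X12) + (Y - (m \o X12)).
    by rewrite [RHS]addrC addrA subrK.
  have mf2 := L2B m2 f2.
  have o : ip P ((m \o X12) - (f \o X12)) (Y - (m \o X12)) = 0.
    by rewrite ipC ipBr// morth fo// subrr.
  by rewrite (nsqB mf2 Ym2) (nsqD mf2 Ym2) o mulr0 subr0 addr0.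
have [argA argB _ EY] := FP.
split.
- have sameA phi : A phi -> mse P' X1 phi = mse P X1 phi.
    move=> Aphi; have mphi : measurable_fun setT (phi \o fst : obs -> _).
      by apply: measurableT_comp => //; exact: A_meas.
    apply: (same (phi \o fst)) => // phi2; apply: orth; apply: L2_sum_fst => //.
    exact/(L2_X12 FP mphi).
  have [Aphi phimin] := argA; split=> // phi' Aphi'.
  by rewrite !sameA//; exact: phimin.
- have sameB psi : B psi -> mse P' X2 psi = mse P X2 psi.
    move=> Bpsi; have mpsi : measurable_fun setT (psi \o snd : obs -> _).
      by apply: measurableT_comp => //; exact: B_meas.
    apply: (same (psi \o snd)) => // psi2; apply: orth; apply: L2_sum_snd => //.
    exact/(L2_X12 FP mpsi).
  have [Bpsi psimin] := argB; split=> // psi' Bpsi'.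
  by rewrite !sameB//; exact: psimin.
- move=> C mC; rewrite -(feasible_X12 FP mC) -P'E//.
  by rewrite -[X in measurable X]setTI; exact: measurable_X12.
(* The second moment of [Y] is the risk of the zero estimator. *)
- have mse0 Q : mse Q X12 0 = ('E_Q[fun w => sqnorm (Y w)])%E.
    by rewrite /mse; congr expectation; apply/funext => w; rewrite subr0.
  rewrite -EY -!mse0; apply: same; first exact: measurable_rV0.
  by move=> _; apply: (orth 0); have [A0 _] := A_sub; rewrite inE in A0;
    exact: (L2_sum_fst A0 (@L2_0 _ _ _ P12 N)).
Qed.

(** The center has the same risk [c - nsq P12 m] under every feasible law, so [rhoM] never exceeds
    it. Averaged over a law and its reflection, the risk of [rhoM] is this value plus the squared
    distance to [m], which must vanish. *)
Lemma minimizer_center rhoM m : F !=set0 -> multi_domain_minimax F rhoM ->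
  center m -> L2 P12 rhoM /\ nsq P12 (rhoM - m) = 0.
Proof.
move=> [P FP] [mrho rhoM_min] cm; have [mm m12 mF] := cm.
have mseE Q : F Q -> mse Q X12 m = (c - nsq P12 m)%:E.
  move=> FQ; have [Y2 Yc] := feasible_Y FQ; have [_ o] := mF _ FQ.
  have m2 : L2 Q (m \o X12) by exact/(L2_X12 FQ mm).
  have := o; rewrite ipBl// => /eqP; rewrite subr_eq0 => /eqP Ym.
  rewrite mse_L2; last exact: L2B.
  by rewrite nsqB// Ym Yc /nsq (ip_X12 FQ m12 m12); congr EFin; ring.
have mse_le Q : F Q -> (mse Q X12 rhoM <= (c - nsq P12 m)%:E)%E.
  move=> FQ; apply: (@le_trans _ _ (ereal_sup [set mse P X12 rhoM | P in F])).
    by apply: ereal_sup_ubound; exists Q.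
  apply: le_trans (rhoM_min _ mm) _.
  by apply: ge_ereal_sup => _ [Q' FQ' <-]; rewrite mseE.
have [Y2 _] := feasible_Y FP.
have mX := @measurable_X12 R M1 M2 N.
have rho2 : L2 P (rhoM \o X12).
  by apply/(mse_ltyP mX mrho Y2); apply: le_lt_trans (mse_le _ FP) (ltry _).
have rho12 : L2 P12 rhoM by exact/(L2_X12 FP mrho).
split=> //; have m2 : L2 P (m \o X12) by exact/(L2_X12 FP mm).
have [P' [FP' P'E]] := feasible_reflect cm FP.
have [Y2' _] := feasible_Y FP'.
have rho2' : L2 P' (rhoM \o X12) by exact/(L2_X12 FP' mrho).
have := mse_le _ FP; have := mse_le _ FP'; have := mseE _ FP.
have Ym := L2B Y2 m2; have mrho2 := L2B m2 rho2; have Yrho' := L2B Y2' rho2'.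
rewrite (mse_L2 Ym) (mse_L2 (L2B Y2 rho2)) (mse_L2 Yrho').
rewrite (transfer_nsq (measurable_mirror mm) P'E Yrho') residual_mirror !lee_fin.
move=> D; have {}D := EFin_inj D; have := parallelogram mrho2 Ym.
have -> : (m \o X12) - (rhoM \o X12) + (Y - (m \o X12)) = Y - (rhoM \o X12).
  by rewrite addrC addrA subrK.
have -> : nsq P12 (rhoM - m) = nsq P ((m \o X12) - (rhoM \o X12)).
  by rewrite -nsqN opprB; have d := L2B m12 rho12; exact: (ip_X12 FP d d).
have := nsq_ge0 P ((m \o X12) - (rhoM \o X12)); lra.
Qed.

(** * Regret of estimators based on the first observation *)

Lemma regretE P (g y : 'rV[R]_M1 -> 'rV[R]_N) :
  F P -> L2_regression P X1 Y g -> measurable_fun setT y ->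
  L2 P (y \o X1) -> REG P y = (nsq P ((g \o X1) - (y \o X1)))%:E.
Proof.
move=> FP rg my y2; have [Y2 _] := feasible_Y FP; have [mg g2 _] := rg.
have mX := @measurable_X1 R M1 M2 N.
have rc := cond_exp_L2_regression mX Y2; have [mc c2 _] := rc.
rewrite /REG (mse_L2 (L2B Y2 y2)) (mse_L2 (L2B Y2 c2)) -EFinB.
rewrite (nsq_regret Y2 rg my y2) (nsq_regret Y2 rg mc c2).
by rewrite (L2_regression_unique mX Y2 rg rc); congr EFin; ring.
Qed.

Lemma regret_pinfty P (y : 'rV[R]_M1 -> 'rV[R]_N) : F P -> measurable_fun setT y ->
  ~ L2 P12 (y \o fst) -> REG P y = +oo%E.
Proof.
move=> FP my ny; have [Y2 _] := feasible_Y FP.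
have mX := @measurable_X1 R M1 M2 N.
have [mc c2 _] := cond_exp_L2_regression mX Y2.
rewrite /REG (mse_L2 (L2B Y2 c2)) mse_pinfty// => y2; apply: ny.
have myf : measurable_fun setT (y \o fst : obs -> _) by exact: measurableT_comp.
exact/(L2_X12 FP myf).
Qed.

(* Reflecting [Y] about [m] turns [E[Y | X1]] into [2 rhoS - E[Y | X1]], so the
   regrets of [y] under the two laws average, by the parallelogram law, to the
   regret of [rhoS] plus the squared distance from [y] to [rhoS]. *)
Lemma regret_reflect m (rhoS y : 'rV[R]_M1 -> 'rV[R]_N) P :
  center m -> L2_regression P12 fst m rhoS -> F P -> measurable_fun setT y -> L2 P12 (y \o fst) ->
  exists P' r a b, [/\ F P', REG P rhoS = r%:E, REG P y = a%:E, REG P' y = b%:E &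
    a + b = 2 * r + 2 * nsq P12 ((y \o fst) - (rhoS \o fst)) /\
    r <= 2 * c + 2 * nsq P12 (rhoS \o fst)].
Proof.
move=> cm [mS S12 oS] FP my y12; have [Y2 Yc] := feasible_Y FP.
have [mm m12 _] := cm.
have mX := @measurable_X1 R M1 M2 N.
have [P' [FP' P'E]] := feasible_reflect cm FP.
have [Y2' _] := feasible_Y FP'.
have mr := measurable_mirror mm.
have mf (h : 'rV[R]_M1 -> 'rV[R]_N) : measurable_fun setT h ->
    measurable_fun setT (h \o fst : obs -> _) by move=> mh; exact: measurableT_comp.
have y2 : L2 P (y \o X1) := iffLR (L2_X12 FP (mf _ my)) y12.
have S2 : L2 P (rhoS \o X1) := iffLR (L2_X12 FP (mf _ mS)) S12.
have m2 : L2 P (m \o X12) := iffLR (L2_X12 FP mm) m12.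
have rg := cond_exp_L2_regression mX Y2.
move: (cond_exp P X1 Y) rg => g rg; have [mg g2 og] := rg.
(* The candidate regression of [Y] under the reflected law. *)
pose g' := (2 : R) *: rhoS - g.
have mg' : measurable_fun setT g' by apply: measurable_rVB => //; exact: measurable_rVZ.
have tX (h : 'rV[R]_M1 -> 'rV[R]_N) : measurable_fun setT h ->
    L2 P' (h \o X1) <-> L2 P (h \o X1).
  move=> mh; apply: (transfer_L2 mr P'E (f := h \o X1)).
  exact: measurableT_comp.
have g'2 : L2 P (g' \o X1) := L2B (L2Z 2 S2) g2.
have rg' : L2_regression P' X1 Y g'.
  split=> //; first exact/(tX _ mg').
  move=> h mh h2'; have h2 := iffLR (tX _ mh) h2'.
  have h12 : L2 P12 (h \o fst) by exact/(L2_X12 FP (mf _ mh)).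
  have Yg' : L2 P' (Y - (g' \o X1)) by apply: L2B => //; exact/(tX _ mg').
  rewrite (transfer_ip mr P'E Yg' h2').
  (* Both terms are residuals of regressions on [X1], hence orthogonal to [h \o X1]. *)
  have -> : (Y - (g' \o X1)) \o mirror m =
      (2 : R) *: ((m \o X12) - (rhoS \o X1)) - (Y - (g \o X1)).
    have E (a b x z : 'rV[R]_N) :
        (2 : R) *: a - x - (2 *: b - z) = 2 *: (a - b) - (x - z).
      by rewrite scalerBr !opprD !opprK !addrA; congr (_ + _); rewrite addrAC.
    by apply/funext => w; exact: E.
  have mS2 := L2B m2 S2; have Yg2 := L2B Y2 g2.
  rewrite (ipBl (L2Z 2 mS2) Yg2 h2) (ipZl 2 mS2 h2) (og _ mh h2) subr0.
  have d12 := L2B m12 S12.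
  have := oS _ mh h12; rewrite (ip_X12 FP d12 h12) => o.
  by rewrite [X in _ * X](o : _ = 0) mulr0.
have y2' : L2 P' (y \o X1) by exact/(tX _ my).
exists P', (nsq P ((g \o X1) - (rhoS \o X1))), (nsq P ((g \o X1) - (y \o X1))),
  (nsq P ((g' \o X1) - (y \o X1))).
have gS2 := L2B g2 S2; have yS2 := L2B y2 S2.
split; [exact: FP'|exact: regretE|exact: regretE| |].
  rewrite (regretE FP' rg' my y2'); congr EFin.
  have d2 : L2 P' ((g' \o X1) - (y \o X1)) by apply: L2B => //; exact/(tX _ mg').
  exact: transfer_nsq mr P'E _ d2.
have -> : nsq P12 ((y \o fst) - (rhoS \o fst)) = nsq P ((y \o X1) - (rhoS \o X1)).
  by have d := L2B y12 S12; exact: (ip_X12 FP d d).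
have -> : nsq P12 (rhoS \o fst) = nsq P (rhoS \o X1) by exact: (ip_X12 FP S12 S12).
(* The regret of [rhoS] is at most its risk, which is at most
   [2 * nsq P Y + 2 * nsq P (rhoS \o X1)]. *)
split; last first.
  have := nsq_regret Y2 rg mS S2.
  have := parallelogram Y2 S2; rewrite Yc.
  have := nsq_ge0 P (Y - (g \o X1)); have := nsq_ge0 P (Y + (rhoS \o X1)).
  lra.
(* The difference of [g - rhoS] and [y - rhoS] is [g - y]; their sum is [- (g' - y)]. *)
rewrite -(parallelogram gS2 yS2); congr (nsq P _ + _).
  by rewrite opprB addrA subrK.
rewrite -[RHS]nsqN; congr (nsq P _).
have E (a b x : 'rV[R]_N) : (2 : R) *: a - b - x = - (b - a + (x - a)).
  by rewrite scaler_nat mulr2n opprD !opprB addrACA addrA.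
by apply/funext => w; exact: E.
Qed.

(** As [rhoM] and [m] are at distance zero, they have the same regression on [X1]; this places
    [rhoS] within reach of [regret_reflect]. *)
Lemma minimizer_regression rhoM m : F !=set0 -> multi_domain_minimax F rhoM ->
  center m -> L2_regression P12 fst m (cond_exp P12 fst rhoM).
Proof.
move=> F0 rM cm; have [_ m12 _] := cm.
have [rho12 d0] := minimizer_center F0 rM cm.
apply: (L2_regression_congr rho12) => //.
by apply: cond_exp_L2_regression => //; exact: measurable_fst.
Qed.

End minimax.

(** * Optimality and uniqueness of the minimax-regret estimator *)

Lemma measurable_cond_exp d (T : measurableType d) (R : realType)
    (P : probability T R) m n (X : T -> 'rV[R]_m) (Z : T -> 'rV[R]_n) :
  measurable_fun setT (cond_exp P X Z).
Proof.
rewrite /cond_exp; case: xgetP => [g _ []//|_]; exact: measurable_cst.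
Qed.

(* The minimizer is determined up to almost sure equality, which is meaningful
   only when the family of distributions is non-empty. *)
Theorem theorem5p1 (R : realType) (M1 M2 N : nat)
    (A : set ('rV[R]_M1 -> 'rV[R]_N)) (B : set ('rV[R]_M2 -> 'rV[R]_N))
    (A_sub : submod_closed (mem A)) (B_sub : submod_closed (mem B))
    (A_meas : forall phi, A phi -> measurable_fun setT phi)
    (B_meas : forall psi, B psi -> measurable_fun setT psi)
    (phiA : 'rV[R]_M1 -> 'rV[R]_N) (psiB : 'rV[R]_M2 -> 'rV[R]_N)
    (P12 : probability ('rV[R]_M1 * 'rV[R]_M2)%type R)
    (c : R) (c_gt0 : 0 < c)
    (rhoM : 'rV[R]_M1 * 'rV[R]_M2 -> 'rV[R]_N)
    (rhoM_min : multi_domain_minimax (feasible A B phiA psiB P12 c) rhoM) :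
  let F := feasible A B phiA psiB P12 c in
  let rhoS := cond_exp P12 fst rhoM in
  single_domain_minimax_regret F rhoS /\
  (F !=set0 -> forall rho, single_domain_minimax_regret F rho ->
    {ae P12, forall x, rho x.1 = rhoS x.1}).
Proof.
move=> F rhoS.
have mrhoS : measurable_fun setT rhoS by exact: measurable_cond_exp.
have regS m : F !=set0 -> center A B phiA psiB P12 c m ->
    L2_regression P12 fst m rhoS.
  by move=> F0 cm; apply: minimizer_regression cm.
split.
  (* For an empty family the supremum is -oo and the comparison is vacuous; otherwise the regret of
     [rhoS] is bounded law by law. *)
  split=> // y my; apply: ge_ereal_sup => _ [P FP <-].
  have le_sup Q : F Q -> (REG Q y <= ereal_sup [set REG P y | P in F])%E.
    by move=> FQ; apply: ereal_sup_ubound; exists Q.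
  have [y12|ny] := pselect (L2 P12 (y \o fst)); last first.
    by apply: le_trans (le_sup _ FP); rewrite (regret_pinfty FP my ny) leey.
  have F0 : F !=set0 by exists P.
  have [m cm] := center_exists A_sub B_sub A_meas B_meas F0.
  (* The average of [a] and [b] is at least [r], so one of the two regrets of [y] is at least that
     of [rhoS]. *)
  have [P' [r [a [b [FP' -> Pa P'b [ab _]]]]]] :=
    regret_reflect A_sub B_sub A_meas B_meas cm (regS _ F0 cm) FP my y12.
  have := le_sup _ FP; have := le_sup _ FP'; rewrite Pa P'b.
  case: (ereal_sup _) => [s| |]; rewrite ?leey ?lee_fin//.
  have := nsq_ge0 P12 ((y \o fst) - (rhoS \o fst)); lra.
move=> F0 rho [mrho rho_min].
have [m cm] := center_exists A_sub B_sub A_meas B_meas F0.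
have rS := regS _ F0 cm; have [_ S12 _] := rS.
have [P0 FP0] := F0.
pose bound := 2 * c + 2 * nsq P12 (rhoS \o fst).
have refl y P := regret_reflect (y := y) (P := P) A_sub B_sub A_meas B_meas cm rS.
set supS := ereal_sup [set REG P rhoS | P in F].
have supS_le : (supS <= bound%:E)%E.
  apply: ge_ereal_sup => _ [P FP <-].
  by have [P' [r [a [b [_ -> _ _ [_ rb]]]]]] := refl _ _ FP mrhoS S12.
have rho_le P : F P -> (REG P rho <= supS)%E.
  move=> FP; apply: le_trans (rho_min _ mrhoS).
  by apply: ereal_sup_ubound; exists P.
have rho12 : L2 P12 (rho \o fst).
  apply: contrapT => nrho; have := le_trans (rho_le _ FP0) supS_le.
  by rewrite (regret_pinfty FP0 mrho nrho) leye_eq.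
(* Finiteness allows the worst-case regret to be cancelled at the end. *)
have supS_fin : supS \is a fin_num.
  have [P' [r [a [b [_ Pr _ _ _]]]]] := refl _ _ FP0 mrhoS S12.
  rewrite fin_numElt (le_lt_trans supS_le (ltry _)) andbT.
  apply: (@lt_le_trans _ _ r%:E); first exact: ltNyr.
  by rewrite -Pr; apply: ereal_sup_ubound; exists P0.
pose s := fine supS; have sE : s%:E = supS by rewrite fineK.
pose dist := nsq P12 ((rho \o fst) - (rhoS \o fst)).
(* Both regrets of [rho] are at most [s] and average to [r + dist], so [r <= s - dist] for every
   feasible law. *)
have sdist : (supS <= (s - dist)%:E)%E.
  apply: ge_ereal_sup => _ [P FP <-].
  have [P' [r [a [b [FP' -> Pa P'b [ab _]]]]]] := refl _ _ FP mrho rho12.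
  have := rho_le _ FP; have := rho_le _ FP'.
  rewrite Pa P'b -sE !lee_fin -/dist in ab *; lra.
have dist0 : dist = 0.
  apply/eqP; rewrite eq_le nsq_ge0 andbT.
  by move: sdist; rewrite -sE lee_fin; lra.
exact: (nsqB_eq0_ae rho12 S12 dist0).
Qed.
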